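(* Let $G:[0,\infty)\to[0,\infty)$ be an increasing function and $X_0\in(0,\infty)$. The upper price in the situation $X_0$ of the perpetual American option with payoff $G(X_t^* )$ is $$X_0\int_{X_0}^{\infty}G(x)x^{-2}\,dx.$$ The upper price in the situation $X_0$ of the European option paying $G(X^*_\infty)$ at time $\infty$ is also $X_0\int_{X_0}^{\infty}G(x)x^{-2}\,dx$.
   Context: ''Increasing'' is meant in the non-strict sense. Trading game: $\mathcal K_0:=\alpha\in\mathbb R$; Market announces $X_0\in[0,\infty)$; for $t=1,2,\dots$: Investor announces $p_t\in\mathbb R$, Market announces $X_t\in[0,\infty)$, and $\mathcal K_t:=\mathcal K_{t-1}+p_t(X_t-X_{t-1})$. A situation is a non-empty finite sequence $(X_0,X_1,\dots,X_t)$ of elements of $[0,\infty)$; $\Sigma$ is the set of all situations. A trading strategy is a function $\Pi:\Sigma\to\mathbb R$, and $$\mathcal K^{\alpha,\Pi}(X_0,\dots,X_t):=\alpha+\sum_{s=1}^t\Pi(X_0,\dots,X_{s-1})(X_s-X_{s-1}).$$ A capital process is a function $\Sigma\to\mathbb R$ of the form $\mathcal K^{\alpha,\Pi}$ for some $\alpha\in\mathbb R$ and some $\Pi$. For $F:\Sigma\to\mathbb R$, the upper price of the perpetual American option with payoff $F$ in a situation $\iota$ is $\inf\{\mathcal K(\iota): \mathcal K(\sigma)\ge F(\sigma)\ \forall\sigma\in\Sigma_\iota\}$, where $\mathcal K$ ranges over the capital processes and $\Sigma_\iota$ is the set of situations having $\iota$ as a prefix. Payoff $G(X_t^* )$ means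 $F(X_0,\dots,X_t):=G(X_t^* )$ with $X_t^*:=\max_{s\le t}X_s$. Let $\Omega$ be the set of all infinite sequences $(X_0,X_1,\dots)$ in $[0,\infty)$. For $F:\Omega\to(-\infty,\infty]$, the upper price in a situation $\iota$ of the European option with maturity date $\infty$ and payoff $F$ is $$\inf\Bigl\{\mathcal K(\iota): \liminf_{t\to\infty}\mathcal K(X_0,\dots,X_t)\ge F(X_0,X_1,\dots)\ \ \forall (X_0,X_1,\dots)\in\Omega_\iota\Bigr\},$$ where $\mathcal K$ ranges over the capital processes and $\Omega_\iota$ is the set of sequences in $\Omega$ having $\iota$ as a prefix. $X_\infty^*:=\sup_{t}X_t\in[0,\infty]$, and $G(\infty):=\lim_{y\to\infty}G(y)$. The infimum of the empty set is $\infty$. *)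

(* Defs.v *)
From HB Require Import structures.
From mathcomp Require Import all_boot all_order all_algebra.
From mathcomp Require Import all_classical all_reals all_analysis.

Set Implicit Arguments.
Unset Strict Implicit.
Unset Printing Implicit Defensive.

Import Order.TTheory GRing.Theory Num.Theory.
Import numFieldNormedType.Exports.

Local Open Scope classical_set_scope.
Local Open Scope ring_scope.

(* The non-empty sequence (X_0, X_1, ..., X_t) is encoded as the pair of its
   head X_0 and its tail [:: X_1; ...; X_t]; hence t is the size of the tail. *)
Definition situation (R : realType) : Type := ({nonneg R} * seq {nonneg R})%type.

Definition strategy (R : realType) : Type := situation R -> R.

Definition horizon (R : realType) (sigma : situation R) : nat := size sigma.2.

Definition price (R : realType) (sigma : situation R) (s : nat) : R :=
  (nth sigma.1 (sigma.1 :: sigma.2) s)%:num.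

(* (X_0, ..., X_s), for s at most the horizon of sigma. *)
Definition history (R : realType) (sigma : situation R) (s : nat) :
  situation R := (sigma.1, take s sigma.2).

Definition capital (R : realType) (alpha : R) (Pi : strategy R)
    (sigma : situation R) : R :=
  alpha + \sum_(1 <= s < (horizon sigma).+1)
    Pi (history sigma s.-1) * (price sigma s - price sigma s.-1).

Definition capital_process (R : realType) : set (situation R -> R) :=
  [set K | exists (alpha : R) (Pi : strategy R), K = capital alpha Pi].

Definition situations_from (R : realType) (iota : situation R) :
    set (situation R) :=
  [set sigma | iota.1 = sigma.1 /\ prefix iota.2 sigma.2].

Definition american_upper_price (R : realType) (F : situation R -> R)
    (iota : situation R) : \bar R :=
  ereal_inf [set (K iota)%:E | K in [set K | capital_process K /\
    forall sigma, situations_from iota sigma -> F sigma <= K sigma]].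

Definition running_max (R : realType) (sigma : situation R) : R :=
  \big[Order.max/sigma.1%:num]_(x <- sigma.2) x%:num.

Definition outcome (R : realType) : Type := nat -> {nonneg R}.

(* (X_0, ..., X_t). *)
Definition initial (R : realType) (X : outcome R) (t : nat) : situation R :=
  (X 0%N, mkseq (fun i => X i.+1) t).

Definition outcomes_from (R : realType) (iota : situation R) : set (outcome R) :=
  [set X | initial X (horizon iota) = iota].

Definition european_upper_price (R : realType) (F : outcome R -> \bar R)
    (iota : situation R) : \bar R :=
  ereal_inf [set (K iota)%:E | K in [set K | capital_process K /\
    forall X, outcomes_from iota X ->
      (F X <= limn_einf (fun t => (K (initial X t))%:E))%E]].

Definition outcome_sup (R : realType) (X : outcome R) : \bar R :=
  ereal_sup (range (fun t => (X t)%:num%:E)).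

(* Extension by G(+oo) := lim_{y -> +oo} G(y); the value at -oo is never
   used, since outcome_sup is nonnegative. *)
Definition extend (R : realType) (G : R -> R) (y : \bar R) : \bar R :=
  match y with
  | r%:E => (G r)%:E
  | +oo%E => lim ((G z)%:E @[z --> +oo%R])
  | -oo%E => 0%E
  end.

(* Main.v *)
Require Import Defs.
From HB Require Import structures.
From mathcomp Require Import all_boot all_order all_algebra.
From mathcomp Require Import all_classical all_reals all_analysis.
From mathcomp Require Import measurable_realfun ring lra.

(* The bounds are chained as V <= American <= European <= V.
   V <= American: against any superhedging capital, sample the market that moves
   along a geometric grid x_i = X_0 r^i, jumping from x_i either to x_(i+1) or
   to 0 with the martingale probabilities; this bounds the initial capital below by
   lower Riemann sums of X_0 G(x) / x^2.
   American <= European: let the price freeze forever after a given situation.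
   European <= V: let H y be the integral of G(x) / x^2 over [y, +oo[. Holding
   c (H (c m) - G (c m) / (c m)) shares when the maximum so far is m (the
   Azema-Yor strategy for the payoff G (c m)) superhedges from the capital
   c X_0 H (c X_0) <= c V, for every c > 1; then c -> 1. *)

Set Implicit Arguments.
Unset Strict Implicit.
Unset Printing Implicit Defensive.

Import Order.TTheory GRing.Theory Num.Theory.
Import numFieldNormedType.Exports.

Local Open Scope classical_set_scope.
Local Open Scope ring_scope.

(** * Capital and running maximum when one price is appended *)

Lemma capital_rcons (R : realType) alpha (Pi : strategy R) x0 s x :
  capital alpha Pi (x0, rcons s x) =
  capital alpha Pi (x0, s) + Pi (x0, s) * (x%:num - (last x0 s)%:num).
Proof.
rewrite /capital /horizon /= size_rcons big_nat_recr//= addrA; congr (_ + _ + _).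
  apply: eq_big_nat => i /andP[i1]; rewrite ltnS => isz.
  congr (Pi (_, _) * _).
    by rewrite -cats1 takel_cat// (leq_trans (leq_pred _)).
  rewrite /price /= -rcons_cons !nth_rcons /= ltnS isz.
  by rewrite (leq_ltn_trans (leq_pred i)).
rewrite /history /= -cats1 take_size_cat// /price /= cats1 -rcons_cons !nth_rcons /=.
by rewrite ltnn eqxx ltnSn nth_last.
Qed.

Lemma running_max_rcons (R : realType) (x0 : {nonneg R}) s x :
  running_max (x0, rcons s x) = Num.max (running_max (x0, s)) x%:num.
Proof.
rewrite /running_max /=; elim: s => [|y s IH] /=.
  by rewrite big_cons !big_nil maxC.
by rewrite !big_cons IH maxA.
Qed.

Lemma running_max_ge (R : realType) (x0 : {nonneg R}) s x :
  x \in x0 :: s -> x%:num <= running_max (x0, s).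
Proof.
elim/last_ind: s x => [|s y IH] x.
  by rewrite inE => /eqP ->; rewrite /running_max /= big_nil.
rewrite -rcons_cons mem_rcons inE running_max_rcons le_max.
by case/orP => [/eqP ->|/IH ->//]; rewrite lexx orbT.
Qed.

Lemma running_max_mem (R : realType) (x0 : {nonneg R}) s :
  exists2 x, x \in x0 :: s & running_max (x0, s) = x%:num.
Proof.
elim/last_ind: s => [|s y [x xs xE]].
  by exists x0; rewrite ?mem_head// /running_max /= big_nil.
rewrite running_max_rcons xE -rcons_cons.
by case: (leP x%:num y%:num) => _; [exists y|exists x] => //;
  rewrite mem_rcons inE ?eqxx ?xs ?orbT.
Qed.

(** * Freezing the price after a situation *)

Lemma capital_cat_nseq (R : realType) alpha (Pi : strategy R) x0 s n :
  capital alpha Pi (x0, s ++ nseq n (last x0 s)) = capital alpha Pi (x0, s).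
Proof.
elim: n => [|n IH]; first by rewrite cats0.
have -> : nseq n.+1 (last x0 s) = rcons (nseq n (last x0 s)) (last x0 s).
  by rewrite -cats1 -[[:: _]]/(nseq 1 _) -nseqD addn1.
rewrite -rcons_cat capital_rcons IH last_cat.
have -> : last (last x0 s) (nseq n (last x0 s)) = last x0 s by elim: (n).
by rewrite subrr mulr0 addr0.
Qed.

(** The default value of [nth] does the freezing: past the end of the list the outcome stays at [z]
    forever. *)
Lemma initial_nth (R : realType) (x0 z : {nonneg R}) s n :
  initial (fun t => nth z (x0 :: s) t) (size s + n) = (x0, s ++ nseq n z).
Proof.
rewrite /initial /=; congr (_, _).
apply: (@eq_from_nth _ z) => [|i]; first by rewrite size_mkseq size_cat size_nseq.
rewrite size_mkseq => ilt; rewrite nth_mkseq// nth_cat nth_nseq.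
by case: ltnP => // sz; rewrite nth_default//; case: ifP.
Qed.

Lemma limn_einf_ge_near (R : realType) (u : nat -> \bar R) (l : \bar R) :
  (\forall n \near \oo, l <= u n)%E -> (l <= limn_einf u)%E.
Proof.
case=> N _ Nu; rewrite limn_einf_lim; apply: lime_ge; first exact: is_cvg_einfs.
exists N => // n /= Nn; apply: le_ereal_inf_tmp => _ [m /= nm <-].
by apply: Nu => /=; rewrite (leq_trans Nn).
Qed.

Lemma outcome_sup_nth_last (R : realType) (x0 : {nonneg R}) s :
  outcome_sup (fun t => nth (last x0 s) (x0 :: s) t) =
  (running_max (x0, s))%:E.
Proof.
apply/le_anti/andP; split.
  apply: ge_ereal_sup => _ [t _ <-]; rewrite lee_fin running_max_ge//.
  have [?|?] := ltnP t (size (x0 :: s)); first exact: mem_nth.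
  by rewrite nth_default// mem_last.
have [x xs ->] := running_max_mem x0 s.
by apply: ereal_sup_ubound; exists (index x (x0 :: s)) => //=; rewrite nth_index.
Qed.

(* An investor who superhedges the European payoff is solvent even if the price
   freezes forever, so she superhedges the American payoff as well. *)
Lemma le_american_european (R : realType) (G : R -> R) (X0 : {nonneg R}) :
  (american_upper_price (fun sigma => G (running_max sigma)) (X0, [::]) <=
   european_upper_price (fun X => extend G (outcome_sup X)) (X0, [::]))%E.
Proof.
apply: le_ereal_inf => _ [K [Kcap Khedge] <-]; exists K => //; split=> //.
move=> [x0 s] [/= <- _] {x0}; case: Kcap Khedge => alpha [Pi ->] hedge.
have := hedge (fun t => nth (last X0 s) (X0 :: s) t) erefl.
rewrite outcome_sup_nth_last /= => /le_trans.
move=> /(_ (capital alpha Pi (X0, s))%:E); rewrite lee_fin; apply.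
have /cvg_limn_einf_sup[-> _] // : (capital alpha Pi
  (initial (fun t => nth (last X0 s) (X0 :: s) t) t))%:E @[t --> \oo] -->
  (capital alpha Pi (X0, s))%:E.
apply: cvg_near_cst; exists (size s) => // n /= sn.
by rewrite -(subnKC sn) initial_nth capital_cat_nseq.
Qed.

(** * The superhedging strategy and the sampled market *)

(* The strategy is the Azema-Yor one: with [D y = H y - G y / y] and current
   maximum [m], holding [c * D (c * m)] shares keeps the capital above
   [G (c * m) + c * D (c * m) * X_t]. *)
Lemma azema_yor_hedge (R : realType) (G H : R -> R) (c : R) (X0 : {nonneg R}) :
  1 <= c -> 0 < X0%:num ->
  (forall a, X0%:num <= a -> G a / a <= H a) ->
  (forall a b, X0%:num <= a -> a <= b -> G a * (a^-1 - b^-1) <= H a - H b) ->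
  exists Pi : strategy R, forall s,
    G (c * running_max (X0, s)) <=
    capital (c * X0%:num * H (c * X0%:num)) Pi (X0, s).
Proof.
move=> c1 X0_gt0 H1 H2; pose D y := H y - G y / y.
have c0 : 0 < c by rewrite (lt_le_trans _ c1).
exists (fun sigma => c * D (c * running_max sigma)) => s.
set K := capital _ _.
have mX t : X0%:num <= running_max (X0, t) by rewrite running_max_ge// mem_head.
have cmX t : X0%:num <= c * running_max (X0, t).
  by rewrite (le_trans (mX t))// ler_peMl// (le_trans _ (mX t))// ltW.
suff : G (c * running_max (X0, s)) +
    c * D (c * running_max (X0, s)) * (last X0 s)%:num <= K (X0, s).
  apply: le_trans; rewrite lerDl mulr_ge0// mulr_ge0//; first exact: ltW.
  by rewrite subr_ge0 H1.
elim/last_ind: s => [|s x IH].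
  rewrite /K /capital /running_max /horizon big_geq//= big_nil addr0 /D.
  rewrite le_eqVlt; apply/orP; left; apply/eqP; field.
  by rewrite !gt_eqF.
rewrite /K capital_rcons -/K last_rcons running_max_rcons.
move: IH (mX s) (cmX s); set m := running_max _; set k := K _ => IH mX' cmX'.
have m0 : 0 < m by rewrite (lt_le_trans X0_gt0).
have {}IH : G (c * m) + c * D (c * m) * x%:num <=
    k + c * D (c * m) * (x%:num - (last X0 s)%:num) by lra.
apply: le_trans IH.
(* Without a new maximum the holding does not change, and the previous bound is already the claim.
   Otherwise the new price [y] is also the new maximum. *)
case: (leP x%:num m) => // mx; set y := x%:num in mx *.
have y0 : 0 < y by rewrite (lt_trans m0).
have := H2 (c * m) (c * y) cmX'; rewrite ler_pM2l// (ltW mx) => /(_ isT) h.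
(* When the price equals the maximum, the payoff term cancels in the invariant. Both sides then
   become [c * y] times quantities that [H2] compares. *)
have -> : G (c * y) + c * D (c * y) * y = c * y * H (c * y).
  by rewrite /D; field; rewrite !gt_eqF.
have -> : G (c * m) + c * D (c * m) * y =
  c * y * (H (c * m) - G (c * m) * ((c * m)^-1 - (c * y)^-1)).
  by rewrite /D; field; rewrite !gt_eqF.
by rewrite ler_pM2l ?mulr_gt0//; lra.
Qed.

(* Sampling the market that moves from [a i] to [a i.+1] or crashes to [0],
   with the martingale probabilities. *)
Lemma grid_lower_bound (R : realType) (G : R -> R) alpha (Pi : strategy R)
    (a : nat -> {nonneg R}) n :
  (forall x y, 0 <= x -> x <= y -> G x <= G y) ->
  (forall i, 0 < (a i)%:num) -> (forall i, (a i)%:num <= (a i.+1)%:num) ->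
  (forall s, G (running_max (a 0%N, s)) <= capital alpha Pi (a 0%N, s)) ->
  \sum_(i < n) G (a i)%:num * ((a i)%:num^-1 - (a i.+1)%:num^-1) +
    capital alpha Pi (initial a n) / (a n)%:num <=
  alpha / (a 0%N)%:num.
Proof.
move=> G_incr a0 a_incr hedge; elim: n => [|n IH].
  by rewrite big_ord0 add0r /capital /initial /horizon big_geq//= addr0.
apply: le_trans IH; rewrite big_ord_recr /= -addrA lerD2l.
rewrite /initial /=.
have -> : mkseq (fun i => a i.+1) n.+1 =
    rcons (mkseq (fun i => a i.+1) n) (a n.+1).
  by rewrite mkseqS.
have lastE : last (a 0%N) (mkseq (fun i => a i.+1) n) = a n.
  by case: n => // n; rewrite (last_nth (a 0%N)) size_mkseq /= nth_mkseq.
(* The crash to [0]: the capital must then still cover [G (a n)], because the maximum already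
   reached is kept. *)
pose z : {nonneg R} := NngNum (lexx (0 : R)).
have := hedge (rcons (mkseq (fun i => a i.+1) n) z).
have : G (a n)%:num <=
    G (running_max (a 0%N, rcons (mkseq (fun i => a i.+1) n) z)).
  apply: G_incr => //; apply: running_max_ge.
  rewrite -rcons_cons mem_rcons in_cons.
  have := mem_last (a 0%N) (mkseq (fun i => a i.+1) n).
  by rewrite lastE => ->; rewrite orbT.
move=> G1 G2; have := le_trans G1 G2.
rewrite !capital_rcons lastE /=.
set k := capital _ _ _; set p := Pi _.
move: (a0 n) (a0 n.+1) (a_incr n).
move: (a n)%:num (a n.+1)%:num => x y x0 y0 xy crash.
(* The jump has probability [x / y] and the crash [(y - x) / y]. Under these weights the gains from
   [p] average to zero; what is subtracted from [k] is the weighted surplus after a crash, which is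
   nonnegative. *)
have -> : G x * (x^-1 - y^-1) + (k + p * (y - x)) / y =
  (k - (k + p * (0 - x) - G x) * ((y - x) / y)) / x.
  by field; rewrite !gt_eqF.
rewrite ler_pM2r ?invr_gt0// gerBl mulr_ge0//; first lra.
by rewrite divr_ge0 ?subr_ge0// ltW.
Qed.

(** * The integral of G(x) / x^2 and its Riemann sums *)

Lemma integral_expN2 (R : realType) (a b : R) : 0 < a -> a <= b ->
  (\int[@lebesgue_measure R]_(x in `[a, b]) (x ^- 2)%:E = (a^-1 - b^-1)%:E)%E.
Proof.
move=> a0; rewrite le_eqVlt => /predU1P[<-|ab].
  by rewrite set_itv1 integral_set1 subrr.
have D (x : R) : 0 < x -> is_derive x 1 (fun y : R => - y^-1) (x ^- 2).
  move=> x0; have h : is_derive x 1 (fun y : R => y^-1) (- x ^- 2 *: 1).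
    by apply: is_deriveV; rewrite gt_eqF.
  by apply: is_derive_eq; rewrite scaler1 opprK.
have cV (x : R) : 0 < x -> {for x, continuous (fun y : R => - y^-1)}.
  by move=> x0; apply: cvgN; apply: inv_continuous; rewrite gt_eqF.
rewrite (@continuous_FTC2 _ _ (fun y => - y^-1)).
- by rewrite -EFinB opprK addrC.
- exact: ab.
- apply/continuous_in_subspaceT => x /[!inE] /=; rewrite in_itv/= => /andP[ax _].
  have x0 : x != 0 by rewrite gt_eqF// (lt_le_trans a0).
  apply: (@continuous_comp _ _ _ (fun y : R => y ^+ 2) (@GRing.inv R)).
    exact: exprn_continuous.
  by apply: inv_continuous; rewrite expf_neq0.
- split.
  + by move=> x; rewrite in_itv/= => /andP[ax _]; have [] := D x (lt_trans a0 ax).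
  + by apply: cvg_at_right_filter; exact: cV.
  + by apply: cvg_at_left_filter; apply: cV; rewrite (lt_trans a0).
- move=> x; rewrite in_itv/= => /andP[ax _].
  by have ? := D x (lt_trans a0 ax); rewrite derive1E derive_val.
Qed.

Lemma measurable_expN2 (R : realType) (D : set R) :
  D `<=` [set x | 0 < x] -> measurable_fun D (fun x : R => x ^- 2).
Proof.
move=> D0; apply: (measurable_funS _ D0).
  by rewrite -set_itvoy; exact: measurable_itv.
rewrite -set_itvoy; apply: open_continuous_measurable_fun.
  exact: interval_open.
move=> x; rewrite inE/= in_itv/= andbT => x0.
apply: (@continuous_comp _ _ _ (fun y : R => y ^+ 2) (@GRing.inv R)).
  exact: exprn_continuous.
by apply: inv_continuous; rewrite expf_neq0// gt_eqF.
Qed.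

Lemma measurable_payoff_expN2 (R : realType) (G : R -> R) (D : set R) :
  (forall x y, 0 <= x -> x <= y -> G x <= G y) ->
  measurable D -> D `<=` [set x | 0 < x] ->
  measurable_fun D (EFin \o (fun x => G x * x ^- 2)).
Proof.
move=> G_incr mD D0; apply/measurable_EFinP; apply: measurable_funM.
  (* [G] is monotone only on the nonnegative reals; cutting its argument off at [0] gives a function
     monotone on the whole line, hence measurable. *)
  apply: (eq_measurable_fun (fun x : R => G (Num.max 0 x))).
    by move=> x /[!inE] /D0 /= x0; rewrite max_r// ltW.
  apply: nondecreasing_measurable => // x y xy; apply: G_incr.
    by rewrite le_max lexx.
  by rewrite ge_max !le_max lexx xy orbT.
exact: measurable_expN2.
Qed.

(** By monotonicity [G] lies between its endpoint values, and x^-2 integrates to [a^-1 - b^-1]. *)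
Lemma itv_payoff_bounds (R : realType) (G : R -> R) (a b : R) :
  (forall x, 0 <= x -> 0 <= G x) ->
  (forall x y, 0 <= x -> x <= y -> G x <= G y) -> 0 < a -> a <= b ->
  ((G a * (a^-1 - b^-1))%:E <=
     \int[@lebesgue_measure R]_(x in `[a, b[) (G x * x ^- 2)%:E <=
   (G b * (a^-1 - b^-1))%:E)%E.
Proof.
move=> G_ge0 G_incr a0 ab; have b0 : 0 < b by rewrite (lt_le_trans a0).
have mG c d : measurable_fun [set` Interval (BSide c a) d]
    (EFin \o (fun x => G x * x ^- 2)).
  apply: measurable_payoff_expN2 => // x /=; rewrite in_itv/= => /andP[+ _].
  by case: c => /=; [exact: lt_le_trans|exact: lt_trans].
have mV : measurable_fun `[a, b] (EFin \o (fun x : R => x ^- 2)).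
  apply/measurable_EFinP; apply: measurable_expN2 => x /=; rewrite in_itv/= => /andP[+ _].
  exact: lt_le_trans.
have c_int c : 0 <= c ->
    ((c * (a^-1 - b^-1))%:E =
    \int[@lebesgue_measure R]_(x in `[a, b]) (c * x ^- 2)%:E)%E.
  move=> c0; under eq_integral do rewrite EFinM.
  rewrite ge0_integralZl//=; first by rewrite integral_expN2.
  by move=> x _; rewrite lee_fin invr_ge0 sqr_ge0.
rewrite integral_itv_bndo_bndc// (c_int (G a)) ?(c_int (G b)); last 2 first.
- exact/G_ge0/ltW.
- exact/G_ge0/ltW.
have pos (x : R) : 0 <= x ^- 2 by rewrite invr_ge0 sqr_ge0.
have mcV c : measurable_fun `[a, b] (EFin \o (fun x : R => c * x ^- 2)).
  by apply/measurable_EFinP/measurable_funM => //; exact/measurable_EFinP.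
apply/andP; split; apply: ge0_le_integral => //=;
  try solve [exact: mcV | exact: mG]; move=> x; rewrite in_itv/= => /andP[ax xb];
  have x0 := ltW (lt_le_trans a0 ax); have a0' := ltW a0; rewrite lee_fin;
  first [by rewrite mulr_ge0 ?G_ge0 ?pos | by rewrite ler_wpM2r ?pos// G_incr].
Qed.

(** The right bound [d] is arbitrary so that the splitting serves both bounded intervals and
    half-lines. *)
Lemma itv_payoff_split (R : realType) (G : R -> R) (a b : R) (d : itv_bound R) :
  (forall x, 0 <= x -> 0 <= G x) ->
  (forall x y, 0 <= x -> x <= y -> G x <= G y) ->
  0 < a -> a <= b -> (BLeft b <= d)%O ->
  (\int[@lebesgue_measure R]_(x in [set` Interval (BLeft a) d])
     (G x * x ^- 2)%:E =
   \int[@lebesgue_measure R]_(x in `[a, b[) (G x * x ^- 2)%:E +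
   \int[@lebesgue_measure R]_(x in [set` Interval (BLeft b) d])
     (G x * x ^- 2)%:E)%E.
Proof.
move=> G_ge0 G_incr a0 ab bd.
have -> : [set` Interval (BLeft a) d] =
    `[a, b[%classic `|` [set` Interval (BLeft b) d].
  by rewrite -itv_bndbnd_setU// bnd_simp.
have pos x : (`[a, b[%classic `|` [set` Interval (BLeft b) d]) x -> 0 < x.
  case => /=; rewrite in_itv/= => /andP[+ _]; first exact: lt_le_trans.
  by apply: lt_le_trans; exact: lt_le_trans ab.
rewrite ge0_integral_setU//=.
- by apply: measurable_payoff_expN2 => //; exact: measurableU.
- move=> x /pos x0.
  by rewrite lee_fin mulr_ge0 ?invr_ge0 ?sqr_ge0// G_ge0// ltW.
- rewrite disj_set2E; apply/eqP/seteqP; split => // x [] /=.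
  by rewrite !in_itv/= => /andP[_ xb] /andP[]; rewrite leNgt xb.
Qed.

(* The weights [1 / a_i - 1 / a_(i+1)] are geometric too, so upper Riemann sums
   are at most [r] times lower ones. *)
Lemma geometric_upper_sum (R : realType) (G : R -> R) (r : R) (a : nat -> R) n :
  (forall x, 0 <= x -> 0 <= G x) ->
  (forall x y, 0 <= x -> x <= y -> G x <= G y) ->
  1 < r -> 0 < a 0%N -> (forall i, a i.+1 = r * a i) ->
  (\int[@lebesgue_measure R]_(x in `[a 0%N, (a n)[) (G x * x ^- 2)%:E <=
   (r * \sum_(i < n.+1) G (a i) * ((a i)^-1 - (a i.+1)^-1))%:E)%E.
Proof.
move=> G_ge0 G_incr r1 a00 aE; have r0 : 0 < r := lt_trans ltr01 r1.
have a0 i : 0 < a i by elim: i => // i IH; rewrite aE mulr_gt0.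
have aS i : a i <= a i.+1 by rewrite aE ler_peMl// ltW.
have w i : (a i)^-1 - (a i.+1)^-1 = r * ((a i.+1)^-1 - (a i.+2)^-1).
  by rewrite !aE; field; rewrite !gt_eqF.
have w0 i : 0 <= (a i)^-1 - (a i.+1)^-1 by rewrite subr_ge0 lef_pV2 ?posrE.
have x0a m : a 0%N <= a m by elim: m => // m /le_trans; apply.
(* This is the upper sum. By [w] each of its weights is [r] times the next one, so an index shift
   turns it into [r] times the lower sum without its first term, which is nonnegative. *)
suff H : (\int[@lebesgue_measure R]_(x in `[a 0%N, (a n)[) (G x * x ^- 2)%:E <=
    (\sum_(i < n) G (a i.+1) * ((a i)^-1 - (a i.+1)^-1))%:E)%E.
  apply: (le_trans H); rewrite lee_fin big_ord_recl mulrDr mulr_sumr.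
  apply: ler_wpDl; first by rewrite !mulr_ge0 ?w0 ?G_ge0 ?(ltW r0) ?(ltW (a0 _)).
  by apply: ler_sum => i _; rewrite w mulrCA.
elim: n => [|n IH].
  by rewrite big_ord0 set_itvco0 integral_set0.
rewrite big_ord_recr EFinD.
rewrite (itv_payoff_split G_ge0 G_incr a00 (x0a n)) ?bnd_simp//.
by apply: leeD => //; have /andP[] := itv_payoff_bounds G_ge0 G_incr (a0 n) (aS n).
Qed.

(** * Limits: factors tending to 1, intervals filling the half-line, unattained suprema *)

Lemma lee_gt1_mul (R : realType) (x y : \bar R) : (0 <= x)%E ->
  (forall c : R, (1 < c)%R -> x <= c%:E * y)%E -> (x <= y)%E.
Proof.
move=> x0 H; apply/lee_mul01Pr => // r /andP[r0 r1].
have := H r^-1; rewrite invf_gt1// => /(_ r1).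
by rewrite -(@lee_pmul2l _ r%:E)// muleA -EFinM mulfV ?gt_eqF// mul1e.
Qed.

(** Bernoulli's inequality bounds the sequence below by one that grows linearly. *)
Lemma geometric_unbounded (R : realType) (r : R) (a : nat -> R) :
  1 < r -> 0 < a 0%N -> (forall i, a i.+1 = r * a i) ->
  forall x, exists n, x < a n.
Proof.
move=> r1 a00 aE x.
have lin n : a 0%N * (1 + n%:R * (r - 1)) <= a n.
  elim: n => [|n IH]; first by rewrite mul0r addr0 mulr1.
  have aS : a 0%N <= a n.
    by apply: le_trans IH; rewrite ler_peMr ?(ltW a00)// lerDl mulr_ge0// subr_ge0 ltW.
  have : (r - 1) * a 0%N <= (r - 1) * a n by rewrite ler_wpM2l// subr_ge0 ltW.
  by rewrite aE -natr1; lra.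
have d0 : 0 < a 0%N * (r - 1) by rewrite mulr_gt0// subr_gt0.
(* The first integer above [x / (a 0 * (r - 1))], where the linear bound exceeds [x]; the maximum
   with [0] handles negative [x]. *)
exists (Num.truncn (Num.max 0 (x / (a 0%N * (r - 1))))).+1.
apply: lt_le_trans (lin _).
set m := Num.max _ _; have m0 : 0 <= m by rewrite le_max lexx.
have : x <= m * (a 0%N * (r - 1)) by rewrite -ler_pdivrMr// le_max lexx orbT.
have /andP[_] := truncn_itv m0; set k := _%:R.
by rewrite -(ltr_pM2r d0); lra.
Qed.

(** Monotone convergence along the increasing intervals up to [a n], which exhaust the half-line. *)
Lemma integral_itvcy_le (R : realType) (G : R -> R) (x0 l : R) (a : nat -> R) :
  (forall x, 0 <= x -> 0 <= G x) ->
  (forall x y, 0 <= x -> x <= y -> G x <= G y) -> 0 < x0 ->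
  {homo a : m n / (m <= n)%N >-> m <= n} -> (forall x, exists n, x < a n) ->
  (forall n, \int[@lebesgue_measure R]_(x in `[x0, (a n)[) (G x * x ^- 2)%:E <=
    l%:E)%E ->
  (\int[@lebesgue_measure R]_(x in `[x0, +oo[) (G x * x ^- 2)%:E <= l%:E)%E.
Proof.
move=> G_ge0 G_incr x00 a_incr a_oo al.
have -> : `[x0, +oo[%classic = \bigcup_n `[x0, (a n)[%classic.
  apply/seteqP; split => [x|x [n _]] /=; rewrite !in_itv/=.
    by rewrite andbT => x0x; have [n xn] := a_oo x; exists n => //=;
      rewrite in_itv/= x0x.
  by move=> /andP[->].
have mf n : measurable_fun `[x0, (a n)[ (EFin \o (fun x => G x * x ^- 2)).
  apply: measurable_payoff_expN2 => // x /=.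
  by rewrite in_itv/= => /andP[+ _]; exact: lt_le_trans.
have f0 n x : `[x0, (a n)[%classic x -> (0 <= (G x * x ^- 2)%:E)%E.
  rewrite /= in_itv/= => /andP[x0x _].
  by rewrite lee_fin mulr_ge0 ?invr_ge0 ?sqr_ge0// G_ge0// (le_trans (ltW x00)).
have nd : nondecreasing_seq (fun n => `[x0, (a n)[%classic).
  move=> m n mn; apply/subsetPset => x /=; rewrite !in_itv/= => /andP[->] /=.
  by move=> /lt_le_trans; apply; exact: a_incr.
have cv := ge0_nondecreasing_set_cvg_integral (mu := @lebesgue_measure R) nd
  (fun n => measurable_itv _) mf f0.
rewrite -(cvg_lim _ cv)//; apply: lime_le; first exact: cvgP cv.
by apply: nearW => n; exact: al.
Qed.

(* A constant ratio [c > 1] absorbs the possible left discontinuity of [G] at a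
   supremum that is not attained. *)
Lemma extend_outcome_sup_le (R : realType) (G : R -> R) (c : R) (l : \bar R)
    (X : outcome R) :
  (forall x y, 0 <= x -> x <= y -> G x <= G y) ->
  1 < c -> 0 < (X 0%N)%:num ->
  (forall t, ((G (c * (X t)%:num))%:E <= l)%E) ->
  (extend G (outcome_sup X) <= l)%E.
Proof.
move=> G_incr c1 X0_gt0 Gl; have c0 : 0 < c := lt_trans ltr01 c1.
have sup_ge t : ((X t)%:num%:E <= outcome_sup X)%E.
  by apply: ereal_sup_ubound; exists t.
(* If [z / c] is strictly below the supremum, some price exceeds it, and [G z] is at most [G] at [c]
   times that price. A finite supremum [r] is itself such a [z]; if the supremum is infinite, every
   [z] qualifies. *)
have below z : 0 <= z -> ((z / c)%:E < outcome_sup X)%E -> ((G z)%:E <= l)%E.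
  move=> z0 /ereal_sup_gt[_ [t _ <-]]; rewrite lte_fin ltr_pdivrMr// mulrC => zt.
  by apply: le_trans (Gl t); rewrite lee_fin G_incr// ltW.
move: (sup_ge 0%N) below; case: (outcome_sup X) => [r| |] //=.
- rewrite lee_fin => /(lt_le_trans X0_gt0) r0; apply; first exact: ltW.
  by rewrite lte_fin ltr_pdivrMr// ltr_pMr.
- move=> _ below; apply: lime_le; last first.
    by exists 0; split => // z z0; apply: below (ltry _); exact: ltW.
  (* Bounding [lim] requires that the limit exist. It does by monotonicity, again after a cut-off at
     [0] that is invisible near infinity. *)
  have : cvg ((G (Num.max 0 z))%:E @[z --> +oo]).
    apply: nondecreasing_is_cvge => x y xy; rewrite lee_fin G_incr//.
      by rewrite le_max lexx.
    by rewrite ge_max !le_max lexx xy orbT.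
  move=> /cvg_ex[y Gy]; apply: (cvgP y); apply: cvg_trans Gy; apply: near_eq_cvg.
  by exists 0; split => // z z0; rewrite max_r// ltW.
Qed.

(** * The lower and upper bounds for the prices *)

Lemma integral_payoff_ge0 (R : realType) (G : R -> R) (a : R) :
  (forall x, 0 <= x -> 0 <= G x) -> 0 < a ->
  (0 <= \int[@lebesgue_measure R]_(x in `[a, +oo[) (G x * x ^- 2)%:E)%E.
Proof.
move=> G_ge0 a0; apply: integral_ge0 => x /=; rewrite in_itv/= andbT => ax.
by rewrite lee_fin mulr_ge0 ?invr_ge0 ?sqr_ge0// G_ge0// (le_trans (ltW a0)).
Qed.

Lemma american_upper_price_ge (R : realType) (G : R -> R) (X0 : {nonneg R}) :
  (forall x, 0 <= x -> 0 <= G x) ->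
  (forall x y, 0 <= x -> x <= y -> G x <= G y) -> 0 < X0%:num ->
  (X0%:num%:E *
     \int[@lebesgue_measure R]_(x in `[X0%:num, +oo[) (G x * x ^- 2)%:E <=
   american_upper_price (fun sigma => G (running_max sigma)) (X0, [::]))%E.
Proof.
move=> G_ge0 G_incr X0_gt0.
apply: le_ereal_inf_tmp => _ [_ [[alpha [Pi ->]] hedge] <-].
have {}hedge s : G (running_max (X0, s)) <= capital alpha Pi (X0, s).
  by apply: hedge; split => //; exact: prefix0s.
have -> : capital alpha Pi (X0, [::]) = alpha.
  by rewrite /capital /horizon big_geq//= addr0.
apply: lee_gt1_mul => [|r r1].
  by apply: mule_ge0; [rewrite lee_fin ltW | exact: integral_payoff_ge0].
have r0 : 0 < r := lt_trans ltr01 r1.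
pose a i : {nonneg R} := NngNum (mulr_ge0 (exprn_ge0 i (ltW r0)) (ltW X0_gt0)).
have a0E : a 0%N = X0 by apply: val_inj; rewrite /= expr0 mul1r.
have aE i : (a i.+1)%:num = r * (a i)%:num by rewrite /= exprS mulrA.
have a_gt0 i : 0 < (a i)%:num by rewrite /= mulr_gt0// exprn_gt0.
have aS i : (a i)%:num <= (a i.+1)%:num by rewrite aE ler_peMl// ltW.
rewrite -EFinM -lee_pdivlMl//.
have -> : ((X0%:num)^-1%:E * (r * alpha)%:E)%E = (r * (alpha / (a 0%N)%:num))%:E.
  by rewrite a0E -EFinM; congr EFin; ring.
apply: (@integral_itvcy_le _ _ _ _ (fun i => (a i)%:num)) => //.
- by apply/nondecreasing_seqP.
- by apply: (geometric_unbounded r1) => //; rewrite a0E.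
- move=> n; rewrite -{1}a0E.
  apply: le_trans (geometric_upper_sum n G_ge0 G_incr r1 (a_gt0 0%N) aE) _.
  rewrite lee_fin ler_pM2l//.
  (* The upper sum up to [a n] has [n.+1] weights, hence [n.+1] market moves. The capital left at
     the end dominates a nonnegative payoff and is dropped. *)
  have := @grid_lower_bound _ G alpha Pi a n.+1 G_incr a_gt0 aS.
  rewrite a0E => /(_ hedge); apply: le_trans; rewrite lerDl.
  apply: divr_ge0 => //; rewrite /initial a0E; apply: le_trans (hedge _).
  by rewrite G_ge0// (le_trans (ltW X0_gt0))// running_max_ge// mem_head.
Qed.

Lemma european_upper_price_le (R : realType) (G : R -> R) (X0 : {nonneg R}) :
  (forall x, 0 <= x -> 0 <= G x) ->
  (forall x y, 0 <= x -> x <= y -> G x <= G y) -> 0 < X0%:num ->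
  (european_upper_price (fun X => extend G (outcome_sup X)) (X0, [::]) <=
   X0%:num%:E *
     \int[@lebesgue_measure R]_(x in `[X0%:num, +oo[) (G x * x ^- 2)%:E)%E.
Proof.
move=> G_ge0 G_incr X0_gt0.
(* Nonnegativity, needed to let [c] tend to 1, comes from the other two links of the chain. *)
have E_ge0 : (0 <=
    european_upper_price (fun X => extend G (outcome_sup X)) (X0, [::]))%E.
  apply: le_trans (le_american_european G X0).
  apply: le_trans (american_upper_price_ge G_ge0 G_incr X0_gt0).
  by apply: mule_ge0; [rewrite lee_fin ltW | exact: integral_payoff_ge0].
pose I y := (\int[@lebesgue_measure R]_(x in `[y, +oo[) (G x * x ^- 2)%:E)%E.
rewrite -/(I _); have I_ge0 y : X0%:num <= y -> (0 <= I y)%E.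
  by move=> X0y; apply: integral_payoff_ge0 => //; exact: lt_le_trans X0y.
(* An infinite integral makes the bound trivial; otherwise all tails are finite and [H] below is a
   genuine real-valued version of [I]. *)
have [Ioo|Ioo] := eqVneq (I X0%:num) +oo%E.
  by rewrite Ioo gt0_muley ?lte_fin// leey.
have split y z : X0%:num <= y -> y <= z -> (I y = \int[@lebesgue_measure R]_(x in
    `[y, z[) (G x * x ^- 2)%:E + I z)%E.
  by move=> X0y yz; apply: itv_payoff_split => //; exact: lt_le_trans X0y.
have bound y z : X0%:num <= y -> y <= z ->
    ((G y * (y^-1 - z^-1))%:E + I z <= I y)%E.
  move=> X0y yz; rewrite (split y z X0y yz) leeD2r//.
  by have /andP[] := itv_payoff_bounds G_ge0 G_incr (lt_le_trans X0_gt0 X0y) yz.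
have w_ge0 y z : X0%:num <= y -> y <= z -> 0 <= G y * (y^-1 - z^-1).
  move=> X0y yz; have y0 := lt_le_trans X0_gt0 X0y; rewrite mulr_ge0 ?G_ge0 ?(ltW y0)//.
  by rewrite subr_ge0 lef_pV2 ?posrE// (lt_le_trans y0).
have Ile y z : X0%:num <= y -> y <= z -> (I z <= I y)%E.
  by move=> X0y yz; apply: le_trans (bound y z X0y yz); rewrite leeDr// lee_fin w_ge0.
pose H y := fine (I y).
have IE y : X0%:num <= y -> I y = (H y)%:E.
  move=> X0y; rewrite fineK// ge0_fin_numE ?I_ge0//.
  by apply: le_lt_trans (Ile _ _ (lexx _) X0y) _; rewrite ltey.
have H2 y z : X0%:num <= y -> y <= z -> G y * (y^-1 - z^-1) <= H y - H z.
  move=> X0y yz; have := bound y z X0y yz.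
  by rewrite !IE ?(le_trans X0y)// -EFinD lee_fin lerBrDr.
have H1 y : X0%:num <= y -> G y / y <= H y.
  move=> X0y; have y0 := lt_le_trans X0_gt0 X0y.
  (* This is [H2] with its right end sent to infinity: [z] is chosen so large that the error
     [G y / z] is at most [e]. *)
  apply/ler_addgt0Pr => e e0; pose z := y + G y / e.
  have yz : y <= z by rewrite lerDl divr_ge0 ?G_ge0 ?(ltW y0)// ltW.
  have z0 := lt_le_trans y0 yz.
  have Hz : 0 <= H z by rewrite -lee_fin -IE ?I_ge0 ?(le_trans X0y).
  have : G y / z <= e.
    by rewrite ler_pdivrMr// /z mulrDr mulrCA mulfV ?gt_eqF// mulr1 lerDr mulr_ge0 ?ltW.
  by have := H2 y z X0y yz; lra.
apply: lee_gt1_mul => // c c1.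
have [Pi hedge] := azema_yor_hedge (ltW c1) X0_gt0 H1 H2.
have cX0 : X0%:num <= c * X0%:num by rewrite ler_peMl ?ltW.
apply: ge_ereal_inf; exists (c * X0%:num * H (c * X0%:num))%:E; last first.
  rewrite EFinM -IE// EFinM muleA lee_wpmul2l ?Ile// -EFinM lee_fin.
  by rewrite mulr_ge0// ltW// (lt_trans _ c1).
exists (capital (c * X0%:num * H (c * X0%:num)) Pi); last first.
  by rewrite /capital /horizon big_geq//= addr0.
split; first by exists (c * X0%:num * H (c * X0%:num)), Pi.
move=> X [X0E]; apply: (extend_outcome_sup_le G_incr c1); rewrite ?X0E// => t.
(* From time [t] on, the running maximum is at least the price at [t], so the capital stays above
   [G] at [c] times that price. *)
apply: limn_einf_ge_near; exists t => // n /= tn.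
rewrite lee_fin /initial X0E; apply: le_trans (hedge _).
have c0 : 0 < c := lt_trans ltr01 c1.
apply: G_incr; first by rewrite mulr_ge0// ltW.
rewrite ler_pM2l// running_max_ge//; case: t tn => [_|t tn].
  by rewrite X0E mem_head.
rewrite in_cons; apply/orP; right; apply/mapP; exists t => //.
by rewrite mem_iota.
Qed.

Theorem corollary7p1 (R : realType) (G : R -> R)
    (G_ge0 : forall x, 0 <= x -> 0 <= G x)
    (G_incr : forall x y, 0 <= x -> x <= y -> G x <= G y)
    (X0 : {nonneg R}) (X0_gt0 : 0 < X0%:num) :
  let V : \bar R := (X0%:num%:E *
    \int[@lebesgue_measure R]_(x in `[X0%:num, +oo[) (G x * x ^- 2)%:E)%E in
  american_upper_price (fun sigma => G (running_max sigma)) (X0, [::]) = V /\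
  european_upper_price (fun X => extend G (outcome_sup X)) (X0, [::]) = V.
Proof.
move=> V; have VA := american_upper_price_ge G_ge0 G_incr X0_gt0.
have AE := le_american_european G X0.
have EV := european_upper_price_le G_ge0 G_incr X0_gt0.
by split; apply/le_anti; rewrite ?VA ?EV ?(le_trans AE EV) ?(le_trans VA AE).
Qed.
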